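(* Suppose $1\leq k<+\infty$, $1\leq m<+\infty$, and suppose $\frac{k}{p}+\frac{m}{q}=1$ and $\frac{k}{p'}+\frac{m}{q'}=1$, with $m<q'<q<+\infty$. Then $$L_T^pL_x^{q,\infty}\subset L_T^{p'}L_x^{q'}+L_T^kL_x^\infty.$$ In particular, for all $f\in L_T^pL_x^{q,\infty}$ we have the explicit decomposition $f=g+h$ with $g\in L_T^{p'}L_x^{q'}$, $h\in L_T^kL_x^\infty$, where $$g(x,t)=\begin{cases}f(x,t),&\text{if }|f(x,t)|>\|f(\cdot,t)\|_{L^{q,\infty}}^{p/k}\\0,&\text{if }|f(x,t)|\leq\|f(\cdot,t)\|_{L^{q,\infty}}^{p/k}\end{cases}$$ and $$h(x,t)=\begin{cases}f(x,t),&\text{if }|f(x,t)|\leq\|f(\cdot,t)\|_{L^{q,\infty}}^{p/k}\\0,&\text{if }|f(x,t)|>\|f(\cdot,t)\|_{L^{q,\infty}}^{p/k}\end{cases},$$ and we have the bounds $$\int_0^T\|g(\cdot,t)\|_{L^{q'}}^{p'}\,dt\leq\left(\frac{q}{q-q'}\right)^{\frac{p'}{q'}}\int_0^T\|f(\cdot,t)\|_{L^{q,\infty}}^p\,dt$$ and $$\int_0^T\|h(\cdot,t)\|_{L^\infty}^k\,dt\leq\int_0^T\|f(\cdot,t)\|_{L^{q,\infty}}^p\,dt.$$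
   Context: The exponents $p',q'$ are just another pair of exponents (not Hölder conjugates). Functions are defined on $\mathbb{R}^3\times[0,T)$, with Lebesgue measure, and take values in $\mathbb{R}^3$, where $|\cdot|$ is the Euclidean norm. For measurable $f$ on $\mathbb{R}^3$ let $\lambda_f(\alpha)=|\{x\in\mathbb{R}^3:|f(x)|>\alpha\}|$ for $\alpha\ge0$; for $1\le q<\infty$, $\|f\|_{L^{q,\infty}}=\left(\sup_{\alpha>0}\alpha^q\lambda_f(\alpha)\right)^{1/q}$, and $L^{q,\infty}$ is the set of measurable $f$ for which this is finite. $L^p_TL^q_x=L^p([0,T);L^q(\mathbb{R}^3))$ with norm $\left(\int_0^T\|f(\cdot,t)\|_{L^q}^p\,dt\right)^{1/p}$ for $p<\infty$, and $L^p_TL^{q,\infty}_x=L^p([0,T);L^{q,\infty}(\mathbb{R}^3))$ with $\|f\|_{L^p_TL^{q,\infty}_x}=\left(\int_0^T\|f(\cdot,t)\|_{L^{q,\infty}}^p\,dt\right)^{1/p}$. For spaces $X,Y$ contained in a common vector space, $X+Y=\{x+y:x\in X,y\in Y\}$. *)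

(* Defs.v *)
From HB Require Import structures.
From mathcomp Require Import all_boot all_order all_algebra.
From mathcomp Require Import all_classical all_reals all_analysis.

Set Implicit Arguments.
Unset Strict Implicit.
Unset Printing Implicit Defensive.

Import Order.TTheory GRing.Theory Num.Theory.
Import numFieldNormedType.Exports.

Local Open Scope classical_set_scope.
Local Open Scope ring_scope.

Notation R3 R := (R * R * R)%type.

(* Euclidean norm; the library norm on a product type is the sup norm. *)
Definition enorm (R : realType) (v : R3 R) : R :=
  Num.sqrt (v.1.1 ^+ 2 + v.1.2 ^+ 2 + v.2 ^+ 2).

Definition borel3 (R : realType) :
    {measure set (R3 (measurableTypeR R)) -> \bar R} :=
  ((@lebesgue_measure R \x @lebesgue_measure R) \x @lebesgue_measure R)%E.

Definition borel31 (R : realType) :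
    {measure set (R3 (measurableTypeR R) * measurableTypeR R)%type -> \bar R} :=
  (borel3 R \x @lebesgue_measure R)%E.

(* R^3 and R^3 x R with their Lebesgue sigma-algebras: the Caratheodory
   completions of the Borel product measures. *)
Definition lebR3 (R : realType) := caratheodory_type ((borel3 R)^*)%mu.

Definition lebR31 (R : realType) := caratheodory_type ((borel31 R)^*)%mu.

Definition leb3 (R : realType) : {measure set (lebR3 R) -> \bar R} :=
  @completed_measure_extension _ _ _ (borel3 R).


Definition timeI (R : realType) (T : \bar R) : set R :=
  [set t | 0 <= t /\ (t%:E < T)%E].

Notation slice f t := (fun x => f (x, t)).

Definition distribution_fun (R : realType) (f : lebR3 R -> R3 R) (a : R) :
    \bar R :=
  leb3 R [set x | a < enorm (f x)].

Definition weak_norm (R : realType) (q : R) (f : lebR3 R -> R3 R) : \bar R :=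
  (ereal_sup [set (a `^ q)%:E * distribution_fun f a
             | a in [set a : R | (0 < a)%R]] `^ q^-1)%E.

Definition strong_norm (R : realType) (q : \bar R) (f : lebR3 R -> R3 R) :
    \bar R :=
  Lnorm (leb3 R) q (fun x => (enorm (f x))%:E).

(* The p-th power of the L^p([0,T); X) norm, N being the norm of X. *)
Definition mixed_pow (R : realType) (T : \bar R) (p : R)
    (N : (lebR3 R -> R3 R) -> \bar R) (f : R3 R * R -> R3 R) : \bar R :=
  (\int[completed_lebesgue_measure]_(t in timeI T) (N (slice f t) `^ p))%E.

(* Elements are functions on R^3 x R of which only the restriction to
   R^3 x [0,T) is constrained. *)
Definition mixed_space (R : realType) (T : \bar R) (p : R)
    (N : (lebR3 R -> R3 R) -> \bar R) : set (R3 R * R -> R3 R) :=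
  [set f | @measurable_fun _ _ (lebR31 R) (R3 R) (setT `*` timeI T) f /\
           (mixed_pow T p N f `^ p^-1 < +oo)%E].

Definition LpLq (R : realType) (T : \bar R) (p : R) (q : \bar R) :=
  mixed_space T p (@strong_norm R q).

Definition LpLqweak (R : realType) (T : \bar R) (p q : R) :=
  mixed_space T p (@weak_norm R q).

Definition sumset (V : zmodType) (X Y : set V) : set V :=
  [set x + y | x in X & y in Y].

(* Extended-valued: it is +oo at times where the weak norm is infinite. *)
Definition level (R : realType) (k p q : R) (f : R3 R * R -> R3 R) (t : R) :
    \bar R :=
  (weak_norm q (slice f t) `^ (p / k))%E.

Definition high_part (R : realType) (k p q : R) (f : R3 R * R -> R3 R) :
    R3 R * R -> R3 R :=
  fun z => if (level k p q f z.2 < (enorm (f z))%:E)%E then f z else 0.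

Definition low_part (R : realType) (k p q : R) (f : R3 R * R -> R3 R) :
    R3 R * R -> R3 R :=
  fun z => if ((enorm (f z))%:E <= level k p q f z.2)%E then f z else 0.

(* Main.v *)
Require Import Defs.
From HB Require Import structures.
From mathcomp Require Import all_boot all_order all_algebra.
From mathcomp Require Import all_classical all_reals all_analysis.
From mathcomp Require Import measurable_realfun ess_sup_inf ring.

Import Order.TTheory GRing.Theory Num.Theory.
Import numFieldNormedType.Exports.

Local Open Scope classical_set_scope.
Local Open Scope ring_scope.

(* On each time slice, with N the weak L^q norm of f(., t), the part of f below
   the level N^(p/k) obviously has L^oo norm at most N^(p/k).  The part g above
   it satisfies |{|g| > a}| <= N^q max(a, N^(p/k))^(-q), and the layer cake
   formula for |g|^q' then gives
   int |g|^q' <= q/(q - q') N^(q + (p/k)(q' - q)).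
   Both estimates hold at every t, also when the slice is not measurable,
   because they only involve outer measures and the integral as a supremum over
   simple functions.  Measurability matters only for g and h themselves: the
   section theorem for Caratheodory-measurable sets shows that N agrees with a
   Borel function of t outside a null set. *)

(** * Outer measures and Caratheodory-measurable sets modulo null sets *)

(** Finiteness yields, for each [n], a countable measurable cover of total measure below the outer
    measure plus 1/(n+1). The intersection over [n] of the unions of these covers is the hull. *)
Lemma measurable_hull {d} {T : measurableType d} {R : realType}
    (mu : {measure set T -> \bar R}) (E : set T) :
  ((mu^*)%mu E < +oo)%E ->
  exists F, [/\ measurable F, E `<=` F & mu F = (mu^*)%mu E].
Proof.
move=> Eoo.
have inv0 n : 0 < n.+1%:R^-1 :> R by rewrite invr_gt0.
have /choice[A AP] n : exists A : (set T)^nat, measurable_cover E A /\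
    (\sum_(0 <= k <oo) mu (A k) < (mu^*)%mu E + n.+1%:R^-1%:E)%E.
  have fE : (mu^*)%mu E \is a fin_num by rewrite ge0_fin_numE// mu_ext_ge0.
  have [_/= [A EA] <-] := lb_ereal_inf_adherent (inv0 n) fE.
  by exists A.
have mA n k : measurable (A n k) by have [[]] := AP n.
have EA n : E `<=` \bigcup_k A n k by have [[]] := AP n.
pose F := \bigcap_n \bigcup_k A n k.
have mF : measurable F.
  by apply: bigcapT_measurable => n; exact: bigcupT_measurable.
have EF : E `<=` F by move=> x Ex n _; exact: EA.
exists F; split => //; apply/eqP; rewrite eq_le; apply/andP; split; last first.
  by rewrite -measurable_mu_extE//; exact: le_mu_ext.
apply/lee_addgt0Pr => /= _/posnumP[e]; near \oo => n.
apply: (@le_trans _ _ (mu (\bigcup_k A n k))).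
  apply: le_measure; rewrite ?inE//; first exact: bigcupT_measurable.
  by move=> x /(_ n I).
apply: (@le_trans _ _ (\sum_(0 <= k <oo) mu (A n k))%E).
  by apply: measure_sigma_subadditive => //; exact: bigcupT_measurable.
apply: le_trans (ltW (AP n).2) _; rewrite leeD// lee_fin ltW//.
by near: n; exact: near_infty_natSinv_lt.
Unshelve. all: by end_near. Qed.

(** On each piece [S i] of finite measure the set has a hull [F], and the excess of [F] has outer
    measure zero, so it has a null hull [G]. Countable unions of the [F] and of the [G] give [B] and
    [N]. *)
Lemma caratheodory_measurable_mod_null {d} {T : measurableType d} {R : realType}
    (mu : {measure set T -> \bar R}) (E : set T) :
  sigma_finite setT mu -> (mu^*)%mu.-cara.-measurable E ->
  exists B N, [/\ measurable B, measurable N, mu N = 0%E,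
    E `<=` B `|` N & B `<=` E `|` N].
Proof.
move=> [S ST mS] mE.
have sub (A : set T) : measurable A -> (mu^*)%mu.-cara.-measurable A.
  by move=> mA; apply: sub_caratheodory; apply: sub_sigma_algebra; exact: mA.
have /choice[P /all_and4[mP1 mP2 P0 /all_and2[PE PB]]] i :
    exists P : set T * set T, [/\ measurable P.1, measurable P.2, mu P.2 = 0%E &
      E `&` S i `<=` P.1 /\ P.1 `<=` (E `&` S i) `|` P.2].
  have [mSi Soo] := mS i.
  have mESi : (mu^*)%mu.-cara.-measurable (E `&` S i).
    by apply: measurableI => //; exact: sub.
  have ESoo : ((mu^*)%mu (E `&` S i) < +oo)%E.
    apply: le_lt_trans Soo; rewrite -(measurable_mu_extE mu)//.
    exact: le_mu_ext.
  have [F [mF EF muF]] := measurable_hull mu _ ESoo.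
  (* Subtraction is legitimate because both sets are Caratheodory measurable and the outer measure
     of [F] is finite. *)
  have FE0 : (mu^*)%mu (F `\` (E `&` S i)) = 0%E.
    have muF' : (mu^*)%mu F = (mu^*)%mu (E `&` S i).
      by rewrite -muF measurable_mu_extE.
    have H : ((mu^*)%mu F < +oo -> (mu^*)%mu (F `\` (E `&` S i)) =
        (mu^*)%mu F - (mu^*)%mu (F `&` (E `&` S i)))%E.
      exact: (@measureD _ _ _ (@completed_measure_extension _ _ _ mu) F
        (E `&` S i) (sub _ mF) mESi).
    rewrite H ?muF'// (setIidr EF) subee// ge0_fin_numE//.
    exact: mu_ext_ge0.
  have FEoo : ((mu^*)%mu (F `\` (E `&` S i)) < +oo)%E by rewrite FE0 ltry.
  (* The excess itself need not lie in the original sigma-algebra, hence a second hull. *)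
  have [G [mG FG muG]] := measurable_hull mu _ FEoo.
  exists (F, G); split => //=; first by rewrite muG.
  split => // x Fx; have [?|?] := pselect ((E `&` S i) x); [by left|right].
  exact: FG.
exists (\bigcup_i (P i).1), (\bigcup_i (P i).2); split.
- exact: bigcupT_measurable.
- exact: bigcupT_measurable.
- apply/negligibleP; first exact: bigcupT_measurable.
  apply: negligible_bigcup => k.
  by apply/negligibleP; [exact: mP2|exact: P0].
- move=> x Ex; left; have : setT x by []. rewrite ST => -[i _ Six].
  by exists i => //; apply: PE.
- by move=> x [i _ /PB[[? _]|?]]; [left|right; exists i].
Qed.

(* The canonical sigma-finite instance of the library on [m1 \x m2] only fires
   for (sub)probability measures [m1] and [m2]. *)
Lemma product_measure_sigma_finite {d1 d2} {T1 : measurableType d1}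
    {T2 : measurableType d2} {R : realType}
    (m1 : {sigma_finite_measure set T1 -> \bar R})
    (m2 : {sigma_finite_measure set T2 -> \bar R}) :
  sigma_finite setT (m1 \x m2)%E.
Proof.
have /sigma_finiteP[F [TF ndF Foo]] := sigma_finiteT m1.
have /sigma_finiteP[G [TG ndG Goo]] := sigma_finiteT m2.
exists (fun n => F n `*` G n) => [|k].
  rewrite -setXTT TF TG; apply/seteqP; split => [[x y] /=|[x y] /= [n _ []]].
    move=> [[n _ Fnx] [k _ Gky]]; exists (maxn n k) => //; split => /=.
      by move: x Fnx; exact/subsetPset/ndF/leq_maxl.
    by move: y Gky; exact/subsetPset/ndG/leq_maxr.
  by move=> ? ?; split; exists n.
have [? ?] := Foo k; have [? ?] := Goo k.
split; first exact: measurableX.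
by rewrite product_measure1E// lte_mul_pinfty// ge0_fin_numE.
Qed.

(** * Sections of Caratheodory-measurable sets *)

(** Replace [A] by a product-measurable [B], up to a null set [N]. By Tonelli almost every section
    of [N] is null, and outside the exceptional set [Z] the sections of [A] and [B] have the same
    outer measure. *)
Lemma caratheodory_ysection {d1 d2} {T1 : measurableType d1}
    {T2 : measurableType d2} {R : realType}
    (m1 : {sigma_finite_measure set T1 -> \bar R})
    (m2 : {sigma_finite_measure set T2 -> \bar R}) (A : set (T1 * T2)) :
  ((m1 \x m2)%E^*)%mu.-cara.-measurable A ->
  exists (G : T2 -> \bar R) (Z : set T2),
    [/\ measurable_fun setT G, measurable Z, m2 Z = 0%E &
        forall t, ~ Z t -> (m1^*)%mu (ysection A t) = G t].
Proof.
move=> mA.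
have [B [N [mB mN N0 AB BA]]] : exists B N, [/\ measurable B, measurable N,
    (m1 \x m2)%E N = 0%E, A `<=` B `|` N & B `<=` A `|` N].
  apply: caratheodory_measurable_mod_null => //.
  exact: product_measure_sigma_finite.
have mGN : measurable_fun setT (m1 \o ysection N).
  exact: measurable_fun_ysection.
have mNt t : measurable (ysection N t) by exact: measurable_ysection.
have mBt t : measurable (ysection B t) by exact: measurable_ysection.
exists (m1 \o ysection B), [set t | m1 (ysection N t) != 0%E]; split.
- exact: measurable_fun_ysection.
- rewrite -[X in measurable X]setTI.
  exact: emeasurable_neq.
(* This integral is the product measure of [N]; a nonnegative function with zero integral vanishes
   almost everywhere. *)
- have : (\int[m2]_y `|m1 (ysection N y)| = 0)%E.
    under eq_integral do rewrite gee0_abs//.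
    have := indic_fubini_tonelli m1 m2 mN.
    rewrite indic_fubini_tonelli_FE// indic_fubini_tonelli_GE// => <-.
    exact: N0.
  move=> /(ae_eq_integral_abs _ measurableT mGN)[N' [mN' N'0 sub]].
  apply: (subset_measure0 _ mN' _ N'0).
    rewrite -[X in measurable X]setTI.
    exact: emeasurable_neq.
  by apply: subset_trans sub => t /= /eqP Nt0 /(_ I).
- move=> t /= /negP; rewrite negbK => /eqP Nt0.
  have muN0 : (m1^*)%mu (ysection N t) = 0%E by rewrite measurable_mu_extE.
  rewrite -(measurable_mu_extE m1)//.
  (* Subadditivity absorbs the null section of [N]; it is applied in both directions. *)
  have U (X Y : set T1) : X `<=` Y `|` ysection N t ->
      ((m1^*)%mu X <= (m1^*)%mu Y)%E.
    move=> XY; apply: (@le_trans _ _ ((m1^*)%mu (Y `|` ysection N t))).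
      exact: le_mu_ext.
    rewrite -[leRHS]adde0 -muN0.
    exact: outer_measureU2.
  apply/eqP; rewrite eq_le !U// => x.
    by move=> /ysectionP/BA[?|?]; [left|right]; exact/ysectionP.
  by move=> /ysectionP/AB[?|?]; [left|right]; exact/ysectionP.
Qed.

(* Packs a measure with a proof of sigma-finiteness; the result is convertible
   to the original measure. *)
Section sigma_finite_pack.
Context {d} {T : measurableType d} {R : realType}.
Variables (mu : {measure set T -> \bar R}) (h : sigma_finite setT mu).

Definition sigma_finite_copy of sigma_finite setT mu : set T -> \bar R := mu.

HB.instance Definition _ := Measure.copy (sigma_finite_copy h) mu.

HB.instance Definition _ :=
  Measure_isSigmaFinite.Build _ _ _ (sigma_finite_copy h) h.

Definition sigma_finite_pack : {sigma_finite_measure set T -> \bar R} :=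
  sigma_finite_copy h.

End sigma_finite_pack.

Lemma borel3_sigma_finite (R : realType) : sigma_finite setT (borel3 R).
Proof.
pose m12 := sigma_finite_pack _
  (product_measure_sigma_finite (@lebesgue_measure R) (@lebesgue_measure R)).
exact: (product_measure_sigma_finite m12 (@lebesgue_measure R)).
Qed.

(** [leb3] is by conversion the outer measure of [borel3], so the section theorem applies
    directly. *)
Lemma lebR31_ysection (R : realType) (A : set (R3 R * R)) :
  measurable (A : set (lebR31 R)) ->
  exists (G : measurableTypeR R -> \bar R) (Z : set (measurableTypeR R)),
    [/\ measurable_fun setT G, measurable Z, @lebesgue_measure R Z = 0%E &
        forall t, ~ Z t -> leb3 R (ysection A t) = G t].
Proof.
exact: (caratheodory_ysection
  (sigma_finite_pack _ (borel3_sigma_finite R)) (@lebesgue_measure R)).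
Qed.

(** * Measurability of the weak norm in time and of the two parts of [f] *)

Lemma measurable_enorm (R : realType) : measurable_fun setT (@enorm R).
Proof.
have -> : @enorm R = (fun v => (v.1.1 ^+ 2 + v.1.2 ^+ 2 + v.2 ^+ 2) `^ 2^-1).
  by apply/funext => v; rewrite powR12_sqrt// !addr_ge0// sqr_ge0.
apply: (measurableT_comp (measurable_powR _)).
apply: measurable_funD; first apply: measurable_funD.
- apply: measurable_funX.
  exact: (measurableT_comp measurable_fst measurable_fst).
- apply: measurable_funX.
  exact: (measurableT_comp measurable_snd measurable_fst).
- exact: measurable_funX.
Qed.

Lemma timeI_measurable (R : realType) (T : \bar R) :
  measurable (timeI T : set (measurableTypeR R)).
Proof.
have -> : timeI T = `[0, +oo[ `&` (EFin @^-1` `]-oo, T[).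
  by apply/seteqP; split => t /=; rewrite !in_itv/= andbT => -[].
apply: measurableI => //.
rewrite -[X in measurable X]setTI.
by apply: EFin_measurable => //; exact: emeasurable_itv.
Qed.

(** Serves to replace the supremum over all levels [a > 0] in the weak norm by a countable one. *)
Lemma positive_rational_seq (R : realType) : exists c : R^nat,
  (forall n, 0 < c n) /\ forall x y, 0 <= x -> x < y -> exists n, x < c n < y.
Proof.
(* Codes of no rational and nonpositive rationals are sent to 1, which keeps every term positive. *)
pose c (n : nat) : R := if @unpickle rat n is Some r then
  (if 0 < ratr r :> R then ratr r else 1) else 1.
exists c; split => [n|x y x0 /rat_in_itvoo[r rxy]].
  by rewrite /c; case: unpickle => // r; case: ifPn.
exists (pickle r); rewrite /c pickleK.
by move: rxy; rewrite in_itv/= => /andP[xr ry]; rewrite (le_lt_trans x0 xr) xr.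
Qed.

(* The points of [c] approach [a] from below, so that monotonicity of [lam]
   suffices: right-continuity may fail for outer measures of non-measurable
   slices. *)
Lemma weak_sup_dense (R : realType) (q : R) (lam : R -> \bar R) (c : R^nat) :
  0 < q -> (forall a, 0 <= lam a)%E ->
  (forall a b, 0 < a -> a < b -> (lam b <= lam a)%E) ->
  (forall n, 0 < c n) ->
  (forall x y, 0 <= x -> x < y -> exists n, x < c n < y) ->
  ereal_sup [set (a `^ q)%:E * lam a | a in [set a : R | (0 < a)%R]]%E =
  ereal_sup (range (fun n => (c n `^ q)%:E * lam (c n)))%E.
Proof.
move=> q0 lam0 lamE c0 cd.
set W := RHS.
apply/eqP; rewrite eq_le; apply/andP; split; last first.
  apply: ge_ereal_sup => _ [n _ <-]; apply: ereal_sup_ubound.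
  by exists (c n); first exact: c0.
have cW n : ((c n `^ q)%:E * lam (c n) <= W)%E.
  by apply: ereal_sup_ubound; exists n.
apply: ge_ereal_sup => _ [a /= a0 <-].
have baW n : c n < a -> ((c n `^ q)%:E * lam a <= W)%E.
  move=> cna; apply: le_trans (cW n).
  by rewrite lee_wpmul2l ?lee_fin ?powR_ge0// lamE.
have [n0 /andP[_ cn0a]] := cd 0 a (lexx _) a0.
(* If [lam a] is infinite, a single [c n] below [a] already forces [W] to be infinite. *)
have := lam0 a; case E: (lam a) => [l||//] => l0; last first.
  have := baW _ cn0a; rewrite E !gt0_muley ?lte_fin ?powR_gt0//.
have W0 : (0 <= W)%E.
  by rewrite (le_trans _ (cW 0%N))// mule_ge0// lee_fin powR_ge0.
case E' : W W0 => [w||//] w0; last by rewrite leey.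
rewrite -EFinM lee_fin leNgt; apply/negP => waql.
rewrite lee_fin in w0.
move: l0; rewrite lee_fin le_eqVlt => /predU1P[l0|l0].
  by move: waql; rewrite -l0 mulr0 ltNge w0.
(* If [w < a^q l], then (w/l)^(1/q) lies below [a]. A [c n] strictly between them satisfies (c n)^q
   l > w, contradicting [baW]. *)
have xa : (w / l) `^ q^-1 < a.
  have -> : a = (a `^ q) `^ q^-1.
    by rewrite -powRrM mulfV ?gt_eqF// powRr1// ltW.
  apply: gt0_ltr_powR; rewrite ?invr_gt0//; last by rewrite ltr_pdivrMr.
  by rewrite nnegrE divr_ge0// ltW.
  by rewrite nnegrE powR_ge0.
have [n /andP[xc ca]] := cd _ _ (powR_ge0 _ _) xa.
have := baW n ca; rewrite E E' -EFinM lee_fin leNgt => /negP; apply.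
rewrite -ltr_pdivrMr//.
have -> : w / l = ((w / l) `^ q^-1) `^ q.
  by rewrite -powRrM mulVf ?gt_eqF// powRr1// divr_ge0// ltW.
by apply: gt0_ltr_powR => //; rewrite nnegrE ?powR_ge0// ltW.
Qed.

Lemma lebR31_borel (R : realType)
    (A : set (R3 (measurableTypeR R) * measurableTypeR R)) :
  measurable A -> measurable (A : set (lebR31 R)).
Proof.
by move=> mA; apply: sub_caratheodory; apply: sub_sigma_algebra; exact: mA.
Qed.

Lemma slab_measurable (R : realType) (T : \bar R) :
  measurable (setT `*` timeI T : set (lebR31 R)).
Proof.
apply: lebR31_borel; apply: measurableX => //; exact: timeI_measurable.
Qed.

Lemma measurable_ereal_sup_range {d} {X : measurableType d} {R : realType}
    (u : nat -> X -> \bar R) :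
  (forall n, measurable_fun setT (u n)) ->
  measurable_fun setT (fun x => ereal_sup (range (fun n => u n x))).
Proof.
move=> mu; have := measurable_fun_esups mu 0%N.
by congr (measurable_fun _ _); apply/funext => x; rewrite /esups/= /sdrop;
  congr ereal_sup; apply/seteqP; split => _ [n _ <-]; exists n.
Qed.

(** At each level [c n] the distribution function agrees with a Borel function of [t] off a null set
    [Z n]. Only countably many levels matter, so the union of the [Z n] is still null. *)
Lemma weak_norm_ae_measurable (R : realType) (T : \bar R) (q : R)
    (f : R3 R * R -> R3 R) : 0 < q ->
  @measurable_fun _ _ (lebR31 R) (R3 R) (setT `*` timeI T) f ->
  exists (G : measurableTypeR R -> \bar R) (Z : set (measurableTypeR R)),
    [/\ measurable_fun setT G, measurable Z, @lebesgue_measure R Z = 0%E &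
        forall t, timeI T t -> ~ Z t -> weak_norm q (slice f t) = G t].
Proof.
move=> q0 mf.
have [c [c0 cd]] := positive_rational_seq R.
pose A n : set (R3 R * R) :=
  (setT `*` timeI T) `&` [set z | c n < enorm (f z)].
have mA n : measurable (A n : set (lebR31 R)).
  have mef : @measurable_fun _ _ (lebR31 R) R (setT `*` timeI T)
      (@enorm R \o f) by exact: measurableT_comp (measurable_enorm R) mf.
  have := mef (slab_measurable R T) `]c n, +oo[%classic (measurable_itv _).
  congr (measurable _); congr (_ `&` _).
  by apply/seteqP; split => z /=; rewrite in_itv/= andbT.
have /choice[G /choice[Z /all_and4[mG mZ Z0 GZ]]] n :=
  lebR31_ysection R _ (mA n).
exists (fun t => ereal_sup (range (fun n => (c n `^ q)%:E * G n t)) `^ q^-1)%E.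
exists (\bigcup_n Z n); split.
- apply: (measurableT_comp (measurable_poweR _)).
  apply: measurable_ereal_sup_range => n.
  exact: measurable_funeM.
- exact: bigcupT_measurable.
- apply/negligibleP; first exact: bigcupT_measurable.
  apply: negligible_bigcup => k.
  by apply/negligibleP; [exact: mZ|exact: Z0].
- move=> t Tt Zt; rewrite /weak_norm; congr (_ `^ _)%E.
  rewrite (@weak_sup_dense R q _ c)//.
  + congr ereal_sup; apply: eq_imagel => n _ /=; congr (_ * _)%E.
    rewrite -GZ; last by move=> Znt; apply: Zt; exists n.
    rewrite /distribution_fun; congr (leb3 R _).
    apply/seteqP; split => x /=; first by move=> ?; apply/ysectionP; split.
    by move=> /ysectionP[].
  + by move=> a b _ ab; apply: le_mu_ext => x /=; exact: lt_trans.
Qed.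

(** The level depends on time alone and equals a Borel function off a null slab; completeness of the
    Lebesgue measure on the product gives measurability. *)
Lemma level_measurable (R : realType) (T : \bar R) (k p q : R)
    (f : R3 R * R -> R3 R) : 0 < q ->
  @measurable_fun _ _ (lebR31 R) (R3 R) (setT `*` timeI T) f ->
  @measurable_fun _ _ (lebR31 R) (\bar R) (setT `*` timeI T)
    (fun z => level k p q f z.2).
Proof.
move=> q0 mf.
have [G [Z [mG mZ Z0 GZ]]] := weak_norm_ae_measurable R T q f q0 mf.
apply: (@ae_measurable_fun _ (lebR31 R) R
  (@completed_measure_extension _ _ _ (borel31 R)) _ _
  (fun z => G z.2 `^ (p / k))%E).
- exact: measure_is_complete_caratheodory.
- exists (setT `*` Z); split.
  + by apply: lebR31_borel; exact: measurableX.
  + transitivity (borel31 R (setT `*` Z)).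
      by apply: measurable_mu_extE; exact: measurableX.
    have -> : borel31 R (setT `*` Z) = (borel3 R setT * lebesgue_measure Z)%E.
      exact: product_measure1E.
    (* The space factor has infinite measure; the convention that infinity times 0 is 0 makes the
       slab null. *)
    by rewrite Z0 mule0.
  + move=> [x t] /= /not_implyP[[_ Tt] neG]; split => //=.
    apply: contrapT => Zt.
    by apply: neG; rewrite /level GZ.
- move=> _ B mB; apply: measurableI; first exact: slab_measurable.
  rewrite -[X in measurable X]setTI.
  apply: lebR31_borel.
  have : measurable_fun setT (fun z : R3 (measurableTypeR R) * measurableTypeR R
      => (G z.2 `^ (p / k))%E).
    apply: (measurableT_comp (measurable_poweR _)).
    exact: measurableT_comp mG measurable_snd.
  exact.
Qed.

Lemma part_measurable (R : realType) (T : \bar R) (k p q : R)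
    (f : R3 R * R -> R3 R) : 0 < q ->
  @measurable_fun _ _ (lebR31 R) (R3 R) (setT `*` timeI T) f ->
  @measurable_fun _ _ (lebR31 R) (R3 R) (setT `*` timeI T)
    (high_part k p q f) /\
  @measurable_fun _ _ (lebR31 R) (R3 R) (setT `*` timeI T) (low_part k p q f).
Proof.
move=> q0 mf.
have mL := level_measurable R T k p q f q0 mf.
have mD := slab_measurable R T.
have mef : @measurable_fun _ _ (lebR31 R) (\bar R) (setT `*` timeI T)
    (fun z => (enorm (f z))%:E).
  by apply/measurable_EFinP; exact: measurableT_comp (measurable_enorm R) mf.
have mP : @measurable_fun _ _ (lebR31 R) bool (setT `*` timeI T)
    (fun z => (level k p q f z.2 < (enorm (f z))%:E)%E).
  by apply: (measurable_fun_bool true); exact: measurable_lte.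
have mP' : @measurable_fun _ _ (lebR31 R) bool (setT `*` timeI T)
    (fun z => ((enorm (f z))%:E <= level k p q f z.2)%E).
  by apply: (measurable_fun_bool true); exact: measurable_lee.
split; apply: measurable_fun_if => //; apply: measurable_funS mf => //.
Qed.

(** * Integral inequalities through simple functions *)

Import HBNNSimple.

(** The integral of a nonnegative function is by definition a supremum over simple functions below
    it, whether or not the function is measurable. *)
Lemma integral_le_ub {d} {T : measurableType d} {R : realType}
    (mu : {measure set T -> \bar R}) (D : set T) (f : T -> \bar R)
    (M : \bar R) : (forall x, D x -> 0 <= f x)%E ->
  (forall h : {nnsfun T >-> R}, (forall x, ((h x)%:E <= (f \_ D) x)%E) ->
    (\int[mu]_x (h x)%:E <= M)%E) ->
  (\int[mu]_(x in D) f x <= M)%E.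
Proof.
move=> f0 hM; rewrite ge0_integralE//.
apply: ge_ereal_sup => _ [h /= hf <-].
by rewrite -integralT_nnsfun; exact: hM.
Qed.

Lemma nnsfun_le_integral {d} {T : measurableType d} {R : realType}
    (mu : {measure set T -> \bar R}) (D : set T) (f : T -> \bar R)
    (h : {nnsfun T >-> R}) : (forall x, D x -> 0 <= f x)%E ->
  (forall x, ((h x)%:E <= (f \_ D) x)%E) ->
  (\int[mu]_x (h x)%:E <= \int[mu]_(x in D) f x)%E.
Proof.
move=> f0 hf; rewrite (ge0_integralE _ f0) integralT_nnsfun.
by apply: ereal_sup_ubound; exists h.
Qed.

(** If a simple [h] lies below [f], then [h / c] is simple and lies below [g]; linearity is used
    only for simple functions. *)
Lemma integral_le_scale {d} {T : measurableType d} {R : realType}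
    (mu : {measure set T -> \bar R}) (D : set T) (f g : T -> \bar R) (c : R) :
  0 < c -> (forall x, D x -> 0 <= f x)%E -> (forall x, D x -> 0 <= g x)%E ->
  (forall x, D x -> f x <= c%:E * g x)%E ->
  (\int[mu]_(x in D) f x <= c%:E * \int[mu]_(x in D) g x)%E.
Proof.
move=> c0 f0 g0 fg; apply: integral_le_ub => // h hf.
have ci0 : 0 <= c^-1 by rewrite invr_ge0 ltW.
pose h' := scale_nnsfun h ci0.
rewrite -lee_pdivrMl//.
apply: (@le_trans _ _ (\int[mu]_x (h' x)%:E)%E).
  rewrite -ge0_integralZl_EFin//; last exact/measurable_EFinP.
  by move=> x _; rewrite lee_fin.
apply: nnsfun_le_integral => // x.
have := hf x; rewrite !patchE; case: ifPn => [|_].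
  rewrite inE => Dx hx.
  rewrite /h'/= EFinM lee_pdivrMl//.
  exact: (le_trans hx (fg _ Dx)).
by rewrite !lee_fin /h'/= => hx; rewrite mulr_ge0_le0.
Qed.

Lemma integral_le {d} {T : measurableType d} {R : realType}
    (mu : {measure set T -> \bar R}) (D : set T) (f g : T -> \bar R) :
  (forall x, D x -> 0 <= f x)%E -> (forall x, D x -> 0 <= g x)%E ->
  (forall x, D x -> f x <= g x)%E ->
  (\int[mu]_(x in D) f x <= \int[mu]_(x in D) g x)%E.
Proof.
move=> f0 g0 fg; rewrite -[leRHS]mul1e.
by apply: integral_le_scale => // x Dx; rewrite mul1e; exact: fg.
Qed.

(** * The layer cake formula and power tails *)

(** Tonelli for the region [E] under the graph: its section at [x] is the interval from 0 to [f x],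
    its section at [s] a superlevel set. The measurability in [s] is recorded for splitting the
    integral later. *)
Lemma layer_cake {d} {T : measurableType d} {R : realType}
    (mu : {sigma_finite_measure set T -> \bar R}) (f : T -> R) :
  measurable_fun setT f -> (forall x, 0 <= f x) ->
  (\int[mu]_x (f x)%:E =
   \int[@lebesgue_measure R]_(s in `]0%R, +oo[) mu [set x | (s < f x)%R])%E /\
  measurable_fun (`]0, +oo[ : set (measurableTypeR R))
    (fun s => mu [set x | s < f x]).
Proof.
move=> mf f0.
pose E : set (T * measurableTypeR R) := [set z | 0 < z.2 /\ z.2 < f z.1].
have mE : measurable E.
  apply: measurableI.
    rewrite -[X in measurable X]setTI.
    have := @measurable_snd _ _ T (measurableTypeR R) measurableT
      `]0, +oo[%classic (measurable_itv _).
    congr (measurable _); congr (_ `&` _).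
    by apply/seteqP; split => z /=; rewrite in_itv/= andbT.
  rewrite -[X in measurable X]setTI.
  have m1 : measurable_fun setT (fun z : T * measurableTypeR R => f z.1).
    exact: measurableT_comp mf measurable_fst.
  have m2 : measurable_fun setT (fun z : T * measurableTypeR R => z.2 : R).
    exact: measurable_snd.
  have /(_ measurableT [set true]) := measurable_fun_ltr m2 m1.
  by rewrite !setTI; exact.
have Es s : 0 < s -> ysection E s = [set x | s < f x].
  move=> s0; apply/seteqP; split => x; first by move=> /ysectionP[].
  by move=> sf; apply/ysectionP.
have Es0 s : ~ (0 < s) -> ysection E s = set0.
  by move=> s0; rewrite -subset0 => x /ysectionP[].
split; last first.
  apply: (eq_measurable_fun (mu \o ysection E)).
    by move=> s; rewrite inE/= in_itv/= andbT => s0; rewrite /= Es.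
  by apply: measurable_funTS; exact: measurable_fun_ysection.
have := indic_fubini_tonelli mu (@lebesgue_measure R) mE.
rewrite indic_fubini_tonelli_FE// indic_fubini_tonelli_GE// => FE.
transitivity (\int[mu]_x ((@lebesgue_measure R) \o xsection E) x)%E.
  apply: eq_integral => x _ /=.
  have -> : xsection E x = `]0, f x[%classic.
    apply/seteqP; split => s.
      by move=> /xsectionP[/= s0 sf]; rewrite /= in_itv/= s0.
    by rewrite /= in_itv/= => /andP[? ?]; apply/xsectionP.
  rewrite lebesgue_measure_itv/= lte_fin sube0.
  by case: ltP => // fx0; congr EFin; apply/eqP; rewrite eq_le fx0 f0.
rewrite FE [RHS]integral_mkcond; apply: eq_integral => s _ /=.
rewrite patchE; case: ifPn => [|/negP]; rewrite inE/= in_itv/= andbT => s0.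
  by rewrite Es.
by rewrite Es0// measure0.
Qed.

Lemma powRN_cvgy0 (R : realType) (a : R) : a < 0 ->
  x `^ a @[x --> +oo] --> (0 : R).
Proof.
move=> a0; apply: (@cvg_trans _ (expR (- (- a * ln x)) @[x --> +oo])).
  apply: near_eq_cvg; near=> x.
  by rewrite /powR gt_eqF// mulNr opprK.
apply: (@cvg_comp _ _ _ (fun x => - a * ln x) (fun y => expR (- y))
  _ (pinfty_nbhs R)); last exact: cvgr_expR.
apply: gt0_cvgMry; first by rewrite oppr_gt0.
apply/cvgryPge => A; near=> x.
rewrite -ler_expR lnK//.
by rewrite posrE.
Unshelve. all: by end_near. Qed.

Lemma continuous_powR (R : realType) (a x : R) : 0 < x ->
  {for x, continuous (fun y => y `^ a)}.
Proof.
move=> x0; apply: differentiable_continuous; apply/derivable1_diffP.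
by apply: derivable_powR; rewrite in_itv/= andbT.
Qed.

(** Fundamental theorem of calculus with primitive s^(1-r)/(1-r), which tends to 0 at infinity
    because [r > 1]. *)
Lemma integral_powRN (R : realType) (r S : R) : 1 < r -> 0 < S ->
  (\int[@lebesgue_measure R]_(s in `[S, +oo[) (s `^ (- r))%:E =
   (S `^ (1 - r) / (r - 1))%:E)%E.
Proof.
move=> r1 S0.
have S_gt x : S <= x -> 0 < x by exact: lt_le_trans.
rewrite (@ge0_continuous_FTC2y _ _ (fun s => (1 - r)^-1 * s `^ (1 - r)) S 0).
- rewrite sub0e -EFinN; congr EFin; rewrite -mulNr -invrN opprB mulrC//.
- by move=> x _; exact: powR_ge0.
- apply/continuous_within_itvcyP; split.
    move=> x; rewrite in_itv/= andbT => Sx.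
    by apply: continuous_powR; exact: lt_trans Sx.
  by apply: cvg_at_right_filter; exact: continuous_powR.
- rewrite -[X in _ --> X](mulr0 (1 - r)^-1).
  by apply: cvgMr; apply: powRN_cvgy0; rewrite subr_lt0.
- move=> x Sx; apply: derivableM => //.
  by apply: derivable_powR; rewrite in_itv/= andbT S_gt// ltW.
- apply: cvgMr; apply: cvg_at_right_filter; exact: continuous_powR.
- move=> x; rewrite in_itv/= andbT => Sx.
  have x0 : 0 < x by rewrite S_gt// ltW.
  rewrite derive1E deriveZ; last first.
    by apply: derivable_powR; rewrite in_itv/= andbT.
  rewrite -derive1E powR_derive1 ?in_itv/= ?andbT//.
  rewrite /GRing.scale/= mulrA mulVf ?mul1r; last by rewrite lt_eqF// subr_lt0.
  by congr (_ `^ _); ring.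
Qed.

(** Split the layer cake integral at [S]. Below [S] the constant bound gives W S^(1-r), above it the
    power tail gives W S^(1-r)/(r-1); the factors add up to 1 + 1/(r-1) = r/(r-1). *)
Lemma weak_tail_integral {d} {T : measurableType d} {R : realType}
    (mu : {sigma_finite_measure set T -> \bar R}) (f : T -> R) (W S r : R) :
  measurable_fun setT f -> (forall x, 0 <= f x) ->
  1 < r -> 0 < S -> 0 < W ->
  (forall s, 0 < s ->
    (mu [set x | (s < f x)%R] <= (W * Num.max s S `^ (- r))%:E)%E) ->
  (\int[mu]_x (f x)%:E <= (W * S `^ (1 - r) * (r / (r - 1)))%:E)%E.
Proof.
move=> mf f0 r1 S0 W0 mW.
have [-> mF] := layer_cake mu f mf f0.
have SE : `]0, +oo[%classic = `]0, S[%classic `|` `[S, +oo[%classic :> set R.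
  apply/seteqP; split => s /=; rewrite !in_itv/= !andbT.
    by move=> s0; case: (ltP s S) => ?; [left|right] => //; rewrite s0.
  by move=> [/andP[]//|]; exact: lt_le_trans.
rewrite SE in mF *.
rewrite ge0_integral_setU//=; last first.
  rewrite disj_set2E; apply/eqP; rewrite -subset0 => s [] /=.
  by rewrite !in_itv/= andbT => /andP[_]; rewrite ltNge => /negP.
have S1 : (\int[@lebesgue_measure R]_(s in `]0%R, S[)
    mu [set x | (s < f x)%R] <= (W * S `^ (1 - r))%:E)%E.
  apply: (@le_trans _ _ (\int[@lebesgue_measure R]_(s in `]0%R, S[)
      (cst (W * S `^ (- r))%:E s))%E).
    apply: integral_le => //= s; rewrite in_itv/= => /andP[s0 sS].
      by rewrite lee_fin mulr_ge0 ?powR_ge0// ltW.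
    by apply: le_trans (mW _ s0) _; rewrite max_r// ltW.
  rewrite integral_cst//= lebesgue_measure_itv/= lte_fin S0 sube0 -EFinM.
  rewrite lee_fin.
  rewrite -mulrA ler_pM2l// powRB; last by rewrite (gt_eqF S0) implybT.
  by rewrite powRN (powRr1 (ltW S0)) mulrC.
have S2 : (\int[@lebesgue_measure R]_(s in `[S, +oo[)
    mu [set x | (s < f x)%R] <= (W * (S `^ (1 - r) / (r - 1)))%:E)%E.
  rewrite EFinM -integral_powRN//.
  apply: integral_le_scale => //= s; rewrite in_itv/= andbT => Ss.
    by rewrite lee_fin powR_ge0.
  by apply: le_trans (mW _ (lt_le_trans S0 Ss)) _; rewrite max_l.
apply: (le_trans (leeD S1 S2)).
rewrite -EFinD lee_fin le_eqVlt; apply/orP; left.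
by apply/eqP; field; rewrite subr_eq0 gt_eqF.
Qed.

Lemma layer_cake_eq0 {d} {T : measurableType d} {R : realType}
    (mu : {sigma_finite_measure set T -> \bar R}) (f : T -> R) :
  measurable_fun setT f -> (forall x, 0 <= f x) ->
  (forall s, 0 < s -> mu [set x | (s < f x)%R] = 0%E) ->
  (\int[mu]_x (f x)%:E = 0)%E.
Proof.
move=> mf f0 mu0; have [-> _] := layer_cake mu f mf f0.
by apply: integral0_eq => s /=; rewrite in_itv/= andbT; exact: mu0.
Qed.

(** * Estimates on a single time slice *)

Lemma leb3_sigma_finite (R : realType) : sigma_finite setT (leb3 R).
Proof.
exact: completed_measure_extension_sigma_finite (borel3_sigma_finite R).
Qed.

Lemma enorm_ge0 (R : realType) (v : R3 R) : 0 <= enorm v.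
Proof. exact: sqrtr_ge0. Qed.

Lemma enorm0 (R : realType) : enorm (0 : R3 R) = 0.
Proof. by rewrite /enorm/= expr0n/= !addr0 sqrtr0. Qed.

(** The Chebyshev form of the weak norm, obtained by undoing the outer power 1/q. *)
Lemma distribution_fun_le (R : realType) (q n a : R) (F : lebR3 R -> R3 R) :
  0 < q -> 0 < a -> weak_norm q F = n%:E ->
  (distribution_fun F a <= (n `^ q * a `^ (- q))%:E)%E.
Proof.
move=> q0 a0; rewrite /weak_norm; set S := ereal_sup _ => SE.
have aS : ((a `^ q)%:E * distribution_fun F a <= S)%E.
  by apply: ereal_sup_ubound; exists a.
have S0 : (0 <= S)%E.
  by apply: le_trans aS; rewrite mule_ge0// lee_fin powR_ge0.
have SnE : S = (n `^ q)%:E.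
  by rewrite -poweR_EFin -SE -poweRrM mulVf ?gt_eqF// poweRe1.
rewrite SnE in aS.
rewrite mulrC powRN EFinM lee_pdivlMl ?powR_gt0//.
Qed.

(** The layer cake formula is applied to simple functions [h] below the truncated power of [|F|],
    since those are measurable. Superlevel sets of [h] lie in superlevel sets of [F], which the weak
    norm controls. *)
Lemma integral_high_le (R : realType) (q r e rho : R) (F : lebR3 R -> R3 R) :
  0 < r -> r < q -> 0 < rho -> 0 < e -> e = q + rho * (r - q) ->
  (\int[leb3 R]_x (`|(enorm (if (weak_norm q F `^ rho < (enorm (F x))%:E)%E
     then F x else 0%R))%:E| `^ r) <=
   (q / (q - r))%:E * weak_norm q F `^ e)%E.
Proof.
move=> r0 rq rho0 e0 eE.
have q0 : 0 < q by exact: lt_trans rq.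
have C0 : 0 < q / (q - r) by rewrite divr_gt0// subr_gt0.
have N0 : (0 <= weak_norm q F)%E by exact: poweR_ge0.
(* For an infinite weak norm the right-hand side is infinite, because [e] is nonzero and the
   constant is positive. *)
case NE : (weak_norm q F) N0 => [n||//] n0; last first.
  by rewrite (poweRyr (lt0r_neq0 e0)) gt0_muley// leey.
rewrite lee_fin in n0.
apply: integral_le_ub => [x _|h hF]; first exact: poweR_ge0.
pose mu := sigma_finite_pack _ (leb3_sigma_finite R).
have mh : measurable_fun setT h by exact: measurable_funP.
pose L := n `^ rho.
have hL s x : 0 < s -> s < h x -> Num.max (s `^ r^-1) L < enorm (F x).
  move=> s0 shx.
  have := hF x; rewrite patch_setT poweR_EFin -/L.
  case: ifPn => [LF|_].
    rewrite lte_fin in LF.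
    rewrite abse_EFin poweR_EFin lee_fin ger0_norm ?enorm_ge0// => hxF.
    rewrite gt_max LF andbT.
    have -> : enorm (F x) = (enorm (F x) `^ r) `^ r^-1.
      by rewrite -powRrM mulfV ?gt_eqF// powRr1// enorm_ge0.
    apply: gt0_ltr_powR; rewrite ?invr_gt0// ?nnegrE ?powR_ge0// ?ltW//.
    exact: lt_le_trans hxF.
  rewrite enorm0 abse0 poweR0r ?gt_eqF// lee_fin => hx0.
  by have := lt_le_trans (lt_trans s0 shx) hx0; rewrite ltxx.
have le_d s b : 0 < s -> b <= Num.max (s `^ r^-1) L ->
    (leb3 R [set x | (s < h x)%R] <= distribution_fun F b)%E.
  move=> s0 bm; apply: le_mu_ext => x /= shx.
  by rewrite (le_lt_trans bm)// hL.
case: (ltgtP n 0) n0 => // [n0|n0] _.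
  have L0 : 0 < L by exact: powR_gt0.
  have S0 : 0 < L `^ r by exact: powR_gt0.
  have SrL : (L `^ r) `^ r^-1 = L.
    by rewrite -powRrM mulfV ?gt_eqF// powRr1// ltW.
  have qr1 : 1 < q / r by rewrite ltr_pdivlMr// mul1r.
  (* Here (q/r)/(q/r - 1) = q/(q - r), and the powers of [n] combine to q + rho r (1 - q/r) = e. *)
  have := weak_tail_integral mu h (n `^ q) (L `^ r) (q / r) mh _ qr1 S0
    (powR_gt0 _ n0).
  have -> : (n `^ q * (L `^ r) `^ (1 - q / r) * (q / r / (q / r - 1)))%:E =
      ((q / (q - r))%:E * n%:E `^ e)%E.
    rewrite poweR_EFin -EFinM; congr EFin; rewrite mulrC; congr (_ * _).
      by field; rewrite !gt_eqF ?subr_gt0.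
    rewrite -[(_ `^ r) `^ _]powRrM -powRrM -powRD; last first.
      by rewrite (gt_eqF n0) implybT.
    by congr (_ `^ _); rewrite eE; field; rewrite gt_eqF.
  (* M^(1/r) is the maximum of s^(1/r) and [L], the level at which the distribution of [F] is
     bounded. *)
  apply => // s s0; set M := Num.max s (L `^ r).
  have M0 : 0 < M by rewrite lt_max s0.
  have -> : M `^ (- (q / r)) = (M `^ r^-1) `^ (- q).
    by rewrite -powRrM mulrN [r^-1 * q]mulrC.
  have Mr0 : 0 < M `^ r^-1 by exact: powR_gt0.
  apply: le_trans (distribution_fun_le R q n (M `^ r^-1) F q0 Mr0 NE).
  apply: le_d => //; rewrite le_max.
  rewrite /M; case: (leP s (L `^ r)) => sL; first by rewrite SrL lexx orbT.
  by rewrite lexx.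
(* With zero weak norm, [F] has null superlevel sets at all positive levels, hence so does [h]. *)
rewrite n0 poweR0r ?gt_eqF// mule0.
rewrite (layer_cake_eq0 mu h mh)// => s s0.
apply/eqP; rewrite eq_le measure_ge0 andbT.
have sr0 : 0 < s `^ r^-1 by exact: powR_gt0.
have := distribution_fun_le R q n (s `^ r^-1) F q0 sr0 NE.
rewrite n0 powR0 ?gt_eqF// mul0r; apply: le_trans.
by apply: le_d => //; rewrite le_max lexx.
Qed.

(** Makes both time exponents explicit, so that the later exponent identities become field
    identities. *)
Lemma exponent_eq (R : realType) (k m p q : R) :
  0 < k -> 0 < m -> m < q -> k / p + m / q = 1 -> p = k * q / (q - m).
Proof.
move=> k0 m0 mq kmpq.
have q0 : q != 0 by rewrite gt_eqF// (lt_trans m0).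
have qm0 : q - m != 0 by rewrite gt_eqF// subr_gt0.
(* Since 1/0 is 0 by convention, [p = 0] would turn the relation into m/q = 1, against [m < q]. *)
have p0 : p != 0.
  apply: contraTneq isT => p0; move: kmpq; rewrite p0 invr0 mulr0 add0r => /eqP.
  by rewrite -subr_eq0 -[1](divff q0) -mulrBl mulf_eq0 invr_eq0 (negPf q0) orbF
    -oppr_eq0 opprB (negPf qm0).
apply: (mulIf qm0); rewrite mulfVK//.
have : p * q * (k / p + m / q) = p * q by rewrite kmpq mulr1.
have -> : p * q * (k / p + m / q) = k * q + p * m by field; rewrite q0 p0.
by move=> E; rewrite mulrBr -E; ring.
Qed.

(** The estimate with [r = q'] and [rho = p / k] is raised to the power p'/q'. As p'/q' = k/(q' -
    m), the exponent of the weak norm becomes e p'/q' = p. *)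
Lemma strong_high_le (R : realType) (k m p q p' q' t : R)
    (f : R3 R * R -> R3 R) :
  0 < k -> 0 < m -> k / p + m / q = 1 -> k / p' + m / q' = 1 ->
  m < q' -> q' < q ->
  (strong_norm q'%:E (slice (high_part k p q f) t) `^ p' <=
   ((q / (q - q')) `^ (p' / q'))%:E * weak_norm q (slice f t) `^ p)%E.
Proof.
move=> k0 m0 kmpq kmpq' mq' q'q.
have q'0 : 0 < q' by exact: lt_trans mq'.
have mq : m < q by exact: lt_trans q'q.
have q0 : 0 < q by exact: lt_trans mq.
have pE := exponent_eq _ _ _ _ _ k0 m0 mq kmpq.
have p'E := exponent_eq _ _ _ _ _ k0 m0 mq' kmpq'.
have qm0 : 0 < q - m by rewrite subr_gt0.
have q'm0 : 0 < q' - m by rewrite subr_gt0.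
have p'q'0 : 0 <= p' / q' by rewrite p'E !divr_ge0 ?mulr_ge0// ltW.
(* This is q + (p/k)(q' - q) with p/k = q/(q - m) inserted; it is positive because [m < q']. *)
pose e := q * (q' - m) / (q - m).
have e0 : 0 < e by rewrite !divr_gt0// mulr_gt0.
have rho0 : 0 < p / k by rewrite pE !divr_gt0// mulr_gt0.
have eE : e = q + p / k * (q' - q).
  by rewrite pE /e; field; rewrite !gt_eqF.
have C0 : 0 <= q / (q - q') by rewrite divr_ge0 ?subr_ge0// ltW.
have := integral_high_le R q q' e (p / k) (slice f t) q'0 q'q rho0 e0 eE.
set I := (X in (X <= _)%E -> _) => Ile.
have I0 : (0 <= I)%E by apply: integral_ge0 => x _; exact: poweR_ge0.
have -> : (strong_norm q'%:E (slice (high_part k p q f) t) `^ p' =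
    I `^ (p' / q'))%E.
  by rewrite /strong_norm unlock -poweRrM mulrC.
have -> : (weak_norm q (slice f t) `^ p =
    (weak_norm q (slice f t) `^ e) `^ (p' / q'))%E.
  rewrite -poweRrM; congr (_ `^ _)%E.
  by rewrite pE p'E /e; field; rewrite !gt_eqF.
rewrite -poweR_EFin -poweRM ?lee_fin ?poweR_ge0//.
by apply: gt0_ler_poweR => //; rewrite in_itv/= ?I0 ?leey// andbT
  mule_ge0// ?poweR_ge0.
Qed.

Lemma strong_low_le (R : realType) (k p q t : R) (f : R3 R * R -> R3 R) :
  0 < k ->
  (strong_norm +oo%E (slice (low_part k p q f) t) `^ k <=
   weak_norm q (slice f t) `^ p)%E.
Proof.
move=> k0.
have -> : (weak_norm q (slice f t) `^ p = level k p q f t `^ k)%E.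
  by rewrite /level -poweRrM divfK// gt_eqF.
have L0 : (0 <= level k p q f t)%E by exact: poweR_ge0.
apply: gt0_ler_poweR; rewrite ?(ltW k0)// ?in_itv/= ?L0 ?leey//.
  by rewrite andbT; exact: Lnorm_ge0.
(* The sup norm is set to 0 on a space of measure zero; that branch follows from [L0]. *)
rewrite /strong_norm unlock; case: ifPn => // _.
apply/ess_supP/nearW => x /=.
rewrite /low_part/=; case: ifPn => [fL|_].
  by rewrite ger0_norm ?enorm_ge0.
by rewrite enorm0 normr0.
Qed.

(** * Integration of the slice estimates in time *)

Theorem theorem1p4 (R : realType) (T : \bar R) (k m p q p' q' : R)
    (T_gt0 : (0 < T)%E) (k_ge1 : 1 <= k) (m_ge1 : 1 <= m)
    (kmpq : k / p + m / q = 1) (kmpq' : k / p' + m / q' = 1)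
    (m_lt_q' : m < q') (q'_lt_q : q' < q) :
  LpLqweak T p q `<=` sumset (LpLq T p' q'%:E) (LpLq T k +oo%E) /\
  forall f : R3 R * R -> R3 R, LpLqweak T p q f ->
    let g := high_part k p q f in
    let h := low_part k p q f in
    [/\ f = g + h,
        LpLq T p' q'%:E g,
        LpLq T k +oo%E h,
        (\int[completed_lebesgue_measure]_(t in timeI T)
            (strong_norm q'%:E (slice g t) `^ p') <=
          ((q / (q - q')) `^ (p' / q'))%:E *
          \int[completed_lebesgue_measure]_(t in timeI T)
            (weak_norm q (slice f t) `^ p))%E &
        (\int[completed_lebesgue_measure]_(t in timeI T)
            (strong_norm +oo%E (slice h t) `^ k) <=
          \int[completed_lebesgue_measure]_(t in timeI T)
            (weak_norm q (slice f t) `^ p))%E ].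
Proof.
have k0 : 0 < k by exact: lt_le_trans k_ge1.
have m0 : 0 < m by exact: lt_le_trans m_ge1.
have mq : m < q by exact: lt_trans q'_lt_q.
have q0 : 0 < q by exact: lt_trans mq.
have p0 : p != 0.
  rewrite (exponent_eq _ _ _ _ _ k0 m0 mq kmpq) gt_eqF//.
  by rewrite divr_gt0 ?subr_gt0// mulr_gt0.
(* The inclusion of spaces follows from the explicit decomposition, so the latter is proved
   first. *)
suff swap (A B : Prop) : B -> (B -> A) -> A /\ B.
  apply: swap => [f [mf foo] g h|H f /H[fE gL hL _ _]]; last first.
    by exists (high_part k p q f) => //; exists (low_part k p q f).
  have [mg mh] := part_measurable R T k p q f q0 mf.
  have gI : (mixed_pow T p' (@strong_norm R q'%:E) g <=
      ((q / (q - q')) `^ (p' / q'))%:E * mixed_pow T p (@weak_norm R q) f)%E.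
    apply: integral_le_scale => [|t _|t _|t _]; try exact: poweR_ge0.
      by rewrite powR_gt0// divr_gt0// subr_gt0.
    exact: (strong_high_le R k m).
  have hI : (mixed_pow T k (@strong_norm R +oo%E) h <=
      mixed_pow T p (@weak_norm R q) f)%E.
    apply: integral_le => t _; try exact: poweR_ge0.
    exact: strong_low_le.
  (* Membership bounds the power 1/p of the integral; as 1/p is nonzero, the integral itself is
     finite. *)
  have Ioo : (mixed_pow T p (@weak_norm R q) f < +oo)%E.
    by apply: lty_poweRy foo; rewrite invr_eq0.
  split => //.
  (* The two conditions are complementary, also at an infinite level, where [g] is 0 and [h] is
     [f]. *)
  - apply/funext => z; rewrite /g /h /high_part /low_part !fctE leNgt.
    by case: ifPn; rewrite ?addr0 ?add0r.
  - split => //; apply: poweR_lty; apply: le_lt_trans gI _.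
    by rewrite lte_mul_pinfty// lee_fin powR_ge0.
  - by split => //; apply: poweR_lty; exact: le_lt_trans hI _.
by move=> b ba; split => //; exact: ba.
Qed.
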